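(* Let $M\in\mathbb{R}^{m\times n}$ and $S\in\mathbb{R}^{d\times m}$ with $n\le d\le m$, and let $M^{\mathrm{pre}}$ be the preconditioned matrix formed (in exact arithmetic) by $\mathtt{cqrrpt\_core}$ with inputs $M$ and $S$. If the restricted condition number $\kappa(S\,|\,\mathrm{range}(M))$ is finite, then the singular values of $M^{\mathrm{pre}}$ are the inverses of the restricted singular values of $S$ on $\mathrm{range}(M)$. That is, with $k=\mathrm{rank}(M)$ and $U$ an $m\times k$ matrix whose columns form an orthonormal basis of $\mathrm{range}(M)$, $\sigma_i(M^{\mathrm{pre}})=\sigma_{k-i+1}(SU)^{-1}$ for $i=1,\dots,k$.
   Context: All matrices are real and arithmetic is exact. Singular values are in decreasing order $\sigma_1\ge\sigma_2\ge\cdots$. ''Orthonormal matrix'' means a matrix with orthonormal columns. Restricted singular values: for a linear subspace $L\subset\mathbb{R}^m$, the restricted singular values of $S$ on $L$ are the singular values of $SU$, where $U$ is any orthonormal matrix with range $L$. The restricted condition number $\kappa(S|L)$ is the ratio of the largest to the smallest restricted singular value (infinite if the smallest is zero). Thus $\kappa(S|\mathrm{range}(M))$ is finite if and only if $\mathrm{rank}(SM)=\mathrm{rank}(M)$. Column-pivoted QR decomposition: for a rank-$k$ matrix $X$ with $n$ columns, it consists of an orthonormal matrix $Q$, an upper-trapezoidal matrix $R$, and a permutation vector $J$ of $\{1,\dots,n\}$ such that $X[:,J]=Q_kR_k$, where $Q_k$ is the first $k$ columns of $Q$ and $R_k$ the first $k$ rows of $R$. Definition of $M^{\mathrm{pre}}$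 in $\mathtt{cqrrpt\_core}(M,S)$: form $M^{\mathrm{sk}}=SM$; compute a column-pivoted QR decomposition $[Q^{\mathrm{sk}},R^{\mathrm{sk}},J]=\mathtt{qrcp}(M^{\mathrm{sk}})$; set $k=\mathrm{rank}(R^{\mathrm{sk}})$; set $A_k^{\mathrm{sk}}=R^{\mathrm{sk}}[1{:}k,1{:}k]$, which is assumed invertible, and $M_k=M[:,J[1{:}k]]$; then $M^{\mathrm{pre}}=M_k(A_k^{\mathrm{sk}})^{-1}\in\mathbb{R}^{m\times k}$.
   Formalization: The column-pivoted QR decomposition is also required to satisfy X[:,J] = QR (rows of R below the k-th contribute nothing); with only X[:,J] = Q_kR_k, rank(R^sk) may exceed rank(SM), and M^pre then has extra zero singular values, so the claim fails. *)

(* Defs.v *)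
From mathcomp Require Import all_boot all_order all_fingroup all_algebra.
From mathcomp Require Import boolp classical_sets reals constructive_ereal.
From mathcomp.real_closed Require Import polyrcf.

Set Implicit Arguments.
Unset Strict Implicit.
Unset Printing Implicit Defensive.

Import Order.TTheory GRing.Theory Num.Theory.
Local Open Scope ring_scope.

Section Defs.
Variable R : realType.

(* The real eigenvalues, repeated according to algebraic multiplicity
   (polyrcf.rootsR lists each real root once). *)
Definition real_eigenvalues n (A : 'M[R]_n) : seq R :=
  flatten [seq nseq (mup x (char_poly A)) x | x <- rootsR (char_poly A)].

(* In decreasing order, one per column of A.  For a matrix with at least as many
   rows as columns these are its min(m, n) = n singular values; a wide matrix
   gets n - m additional zeros, so that in all cases the last entry is zero
   exactly when A is not injective. *)
Definition singular_values m n (A : 'M[R]_(m, n)) : seq R :=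
  sort >=%R [seq Num.sqrt x | x <- real_eigenvalues (A^T *m A)].

(* 1-based: [sigma A 1] is the largest singular value. *)
Definition sigma m n (A : 'M[R]_(m, n)) (i : nat) : R :=
  (singular_values A)`_i.-1.

Definition orthonormal m k (U : 'M[R]_(m, k)) : Prop := U^T *m U = 1%:M.

Definition mxrange m n (A : 'M[R]_(m, n)) : {vspace 'cV[R]_m} :=
  limg (linfun (mulmx A : 'cV[R]_n -> 'cV[R]_m)).

Definition orthonormal_basis_of m k (L : {vspace 'cV[R]_m}) (U : 'M[R]_(m, k)) :
    Prop :=
  orthonormal U /\ mxrange U = L.

Definition some_orthonormal_basis m (L : {vspace 'cV[R]_m}) :
    'M[R]_(m, \dim L) :=
  xget 0 [set U | orthonormal_basis_of L U]%classic.

(* Independent of the chosen basis: two orthonormal bases of L differ by an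
   orthogonal factor on the right. *)
Definition restricted_singular_values d m (S : 'M[R]_(d, m))
    (L : {vspace 'cV[R]_m}) : seq R :=
  singular_values (S *m some_orthonormal_basis L).

(* For L = 0 there is no restricted singular value; the default 1 makes the
   condition number of S on 0 equal to 1, so that finiteness is equivalent to
   the injectivity of S on L for every L. *)
Definition restricted_cond d m (S : 'M[R]_(d, m)) (L : {vspace 'cV[R]_m}) :
    \bar R :=
  let s := restricted_singular_values S L in
  if last 1 s == 0 then +oo%E else (head 1 s / last 1 s)%:E.

(* Multiplication by [pid_mx k] on the right (resp. left) selects the first k
   columns (resp. rows). *)
Definition first_cols k m n (A : 'M[R]_(m, n)) : 'M[R]_(m, k) :=
  A *m pid_mx k.

Definition first_rows k m n (A : 'M[R]_(m, n)) : 'M[R]_(k, n) :=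
  pid_mx k *m A.

(* [col_perm J X] is X[:, J].  The inner dimension p is left free so as to cover
   full (p = d), economic (p = min(d, n)) and rank-sized (p = k) factors.
   [is_trig_mx] means lower triangular, hence the transpose.  The equation
   X[:, J] = Q R says that the rows of R below the k-th, which do not occur in
   Q_k R_k, vanish. *)
Definition is_qrcp d n p (X : 'M[R]_(d, n))
    (Q : 'M[R]_(d, p)) (T : 'M[R]_(p, n)) (J : 'S_n) : Prop :=
  let k := \rank X in
  [/\ orthonormal Q,
      is_trig_mx T^T,
      col_perm J X = Q *m T &
      col_perm J X = first_cols k Q *m first_rows k T].

Definition leading_block n p (T : 'M[R]_(p, n)) : 'M[R]_(\rank T) :=
  first_cols (\rank T) (first_rows (\rank T) T).

(* The matrix M^pre of cqrrpt_core, given the factor R^sk and the pivots J of a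
   column-pivoted QR decomposition of the sketch S M. *)
Definition cqrrpt_precond m n p (M : 'M[R]_(m, n)) (Rsk : 'M[R]_(p, n))
    (J : 'S_n) : 'M[R]_(m, \rank Rsk) :=
  first_cols (\rank Rsk) (col_perm J M) *m invmx (leading_block Rsk).

End Defs.

(* Main.v *)
Require Import Defs.
From mathcomp Require Import all_boot all_order all_fingroup all_algebra.
From mathcomp Require Import boolp classical_sets reals constructive_ereal.
From mathcomp.real_closed Require Import polyrcf complex.

Set Implicit Arguments.
Unset Strict Implicit.
Unset Printing Implicit Defensive.

Import Order.TTheory GRing.Theory Num.Theory.
Local Open Scope ring_scope.

(** Let U be an orthonormal basis matrix of range M and W = S U.  The columns of
    M^pre are combinations of columns of M, so M^pre = U X for some X.  The
    QR factorisation of the sketch says that S M^pre, which is W X, is the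
    matrix of the first k columns of Q^sk, hence has orthonormal columns
    ([qrcp_sketch_orthonormal]).  Finiteness of the restricted condition number
    makes the Gram matrix W^T W invertible ([gram_unitmx]), so that S loses no
    rank on range M and X is square of size k = rank M.

    From X^T (W^T W) X = 1 follows X X^T = (W^T W)^-1, while the Gram matrix of
    M^pre is X^T X, because U^T U = 1.  As X^T X and X X^T are similar, the
    eigenvalues of the Gram matrix of M^pre are the inverses of those of W^T W,
    and the square roots correspond likewise ([singular_values_inverse]).
    Inversion reverses the order, whence the index k - i + 1.

    The multisets of singular values only behave as expected once the
    characteristic polynomial of a real symmetric matrix is known to split over
    the reals.  This is obtained in [symmetric_char_poly] from the spectral
    theorem for Hermitian matrices over R[i].  The restricted singular values
    are those of one chosen orthonormal basis, whose existence is proved by the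
    Gram-Schmidt process ([exists_orthonormal_submx]).  Comparing the singular
    values of S U with those of M^pre for every orthonormal basis U shows in
    passing that they do not depend on U. *)

(** * Characteristic polynomials of symmetric matrices *)

Lemma char_poly_similar (F : fieldType) n (P A B : 'M[F]_n) :
  P \in unitmx -> P *m A = B *m P -> char_poly A = char_poly B.
Proof.
move=> uP eqPA; set P' := map_mx polyC P.
have eqP' : P' *m char_poly_mx A = char_poly_mx B *m P'.
  rewrite /char_poly_mx mulmxBr mulmxBl -!map_mxM eqPA.
  by rewrite mul_mx_scalar mul_scalar_mx.
have dP'_neq0 : \det P' != 0.
  by rewrite det_map_mx polyC_eq0 -unitfE -unitmxE.
by apply: (mulfI dP'_neq0); rewrite -det_mulmx eqP' det_mulmx mulrC.
Qed.

Lemma char_poly_diag (F : comNzRingType) n (d : 'rV[F]_n) :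
  char_poly (diag_mx d) = \prod_(i < n) ('X - (d 0 i)%:P).
Proof.
rewrite char_poly_trig ?diag_mx_is_trig //.
by apply: eq_bigr => i _; rewrite mxE eqxx.
Qed.

(** Both characteristic polynomials come from one diagonalisation
    G = P^-1 D P over R[i], with D real because G is Hermitian; treating them
    together is what pairs each eigenvalue of G with its inverse. *)
Lemma symmetric_char_poly (R : rcfType) n (G : 'M[R]_n) : G^T = G ->
  exists s : seq R,
    [/\ size s = n, char_poly G = \prod_(x <- s) ('X - x%:P) &
        G \in unitmx -> char_poly (invmx G) = \prod_(x <- s) ('X - x^-1%:P)].
Proof.
move=> symG; pose GC := map_mx (real_complex R) G.
have hermGC : GC \is hermsymmx.
  apply: realsym_hermsym.
    by apply/is_hermitianmxP; rewrite expr0 scale1r map_mx_id // map_trmx symG.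
  by apply/mxOverP => i j; rewrite mxE complex_real.
have /orthomx_spectralP GCE := hermitian_normalmx hermGC.
have /mxOverP dreal := hermitian_spectral_diag_real hermGC.
set P := spectralmx GC in GCE; have uP : P \in unitmx by exact: spectral_unit.
pose d := map_mx (@complex.Re R) (spectral_diag GC).
have dE : spectral_diag GC = map_mx (real_complex R) d.
  by apply/matrixP => i j; rewrite !mxE RRe_real.
have PGC : P *m GC = diag_mx (spectral_diag GC) *m P.
  by rewrite [in LHS]GCE -!mulmxA mulKVmx.
exists [seq d 0 i | i <- enum 'I_n].
split; first by rewrite size_map size_enum_ord.
  apply: (map_poly_inj (real_complex R)).
  rewrite map_char_poly (char_poly_similar uP PGC) char_poly_diag dE.
  rewrite big_map big_enum rmorph_prod; apply: eq_bigr => i _.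
  by rewrite rmorphB /= map_polyX map_polyC mxE.
move=> uG; have uGC : GC \in unitmx by rewrite map_unitmx.
have uD : diag_mx (spectral_diag GC) \in unitmx.
  by rewrite -(mulmxK uP (diag_mx _)) -PGC !unitmx_mul uP uGC unitmx_inv.
have d_neq0 i : spectral_diag GC 0 i != 0.
  move: uD; rewrite unitmxE det_diag unitfE => /prodf_neq0 d_neq0.
  exact: d_neq0.
pose e : 'rV[R[i]]_n := map_mx (real_complex R) (map_mx (@GRing.inv R) d).
have eD : diag_mx e *m diag_mx (spectral_diag GC) = 1%:M.
  apply/matrixP => i j; rewrite mul_diag_mx !mxE.
  case: eqVneq => [_|_]; last by rewrite !mulr0n mulr0.
  by rewrite fmorphV /= RRe_real // mulVf.
have ePGC : diag_mx e *m P *m GC = P.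
  by rewrite -mulmxA PGC mulmxA eD mul1mx.
have PGCV : P *m invmx GC = diag_mx e *m P.
  by rewrite -[in LHS]ePGC (mulmxK uGC).
apply: (map_poly_inj (real_complex R)).
rewrite map_char_poly map_invmx (char_poly_similar uP PGCV) char_poly_diag.
rewrite big_map big_enum rmorph_prod; apply: eq_bigr => i _.
by rewrite rmorphB /= map_polyX map_polyC !mxE.
Qed.

(** * Singular values through the Gram matrix *)

Section SingularValues.
Variable R : realType.

Lemma perm_real_eigenvalues n (A : 'M[R]_n) (s : seq R) :
  char_poly A = \prod_(x <- s) ('X - x%:P) -> perm_eq (real_eigenvalues A) s.
Proof.
rewrite /real_eigenvalues => chA.
have chA_neq0 : char_poly A != 0 by rewrite monic_neq0 ?char_poly_monic.
apply/allP => x _; apply/eqP; rewrite -(mu_prod_XsubC x s) -chA.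
rewrite count_flatten -map_comp sumnE big_map.
rewrite (eq_bigr (fun y => if y == x then mup y (char_poly A) else 0%N)).
  have [xr|xNr] := boolP (x \in rootsR (char_poly A)).
    rewrite (bigD1_seq x) ?uniq_roots //= eqxx big1 ?addn0 // => y.
    by move/negbTE->.
  rewrite big_seq big1 => [|y yr]; last first.
    by case: eqP => // xE; rewrite -xE yr in xNr.
  rewrite mupNroot //; apply: contra xNr => rx.
  by rewrite -(roots_on_rootsR chA_neq0) rx in_itv.
move=> y _ /=; rewrite count_nseq /=.
by case: (y == x); rewrite ?mul1n ?mul0n.
Qed.

Lemma singular_values_eigen m n (A : 'M[R]_(m, n)) (s : seq R) :
  char_poly (A^T *m A) = \prod_(x <- s) ('X - x%:P) ->
  perm_eq (singular_values A) (map Num.sqrt s).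
Proof.
by move=> chA; rewrite perm_sort perm_map ?perm_real_eigenvalues.
Qed.

Lemma trmx_gram m n (A : 'M[R]_(m, n)) : (A^T *m A)^T = A^T *m A.
Proof. by rewrite trmx_mul trmxK. Qed.

Lemma size_singular_values m n (A : 'M[R]_(m, n)) :
  size (singular_values A) = n.
Proof.
have [s [size_s chA _]] := symmetric_char_poly (trmx_gram A).
by rewrite (perm_size (singular_values_eigen chA)) size_map.
Qed.

Lemma singular_values_sorted m n (A : 'M[R]_(m, n)) :
  sorted >=%R (singular_values A).
Proof. by apply: sort_sorted => x y; exact: le_total. Qed.

(** The list is decreasing with nonnegative entries, so its last entry bounds
    the others from below. *)
Lemma singular_values_gt0 m n (A : 'M[R]_(m, n)) :
  last 1 (singular_values A) != 0 -> {in singular_values A, forall s, 0 < s}.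
Proof.
move=> last_neq0 s s_in; set t := singular_values A in last_neq0 s_in *.
have t_gt0 : (0 < size t)%N by case: t s_in {last_neq0}.
have lastE : last 1 t = nth 1 t (size t).-1 by rewrite nth_last.
have last_in : last 1 t \in t by rewrite lastE mem_nth // prednK.
have last_gt0 : 0 < last 1 t.
  rewrite lt0r last_neq0 /=; move: last_in.
  by rewrite mem_sort => /mapP[z _ ->]; exact: sqrtr_ge0.
apply: (lt_le_trans last_gt0); rewrite lastE -(nth_index 1 s_in).
have ge_tr : transitive (>=%R : rel R) by move=> y x z; exact: ge_trans.
have ge_refl : reflexive (>=%R : rel R) by move=> x; exact: lexx.
apply: (sorted_leq_nth ge_tr ge_refl 1 (singular_values_sorted A)).
- by rewrite inE index_mem.
- by rewrite inE prednK.
- by rewrite -ltnS prednK // index_mem.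
Qed.

(** With G = W^T W, the hypothesis on W X reads X^T G X = 1, that is
    X X^T = G^-1; and (U X)^T (U X) = X^T X is conjugate to X X^T through X. *)
Lemma singular_values_inverse m d k (U : 'M[R]_(m, k)) (W : 'M[R]_(d, k))
    (X : 'M[R]_k) : Defs.orthonormal U -> Defs.orthonormal (W *m X) ->
  perm_eq (singular_values (U *m X)) [seq s^-1 | s <- singular_values W].
Proof.
rewrite /Defs.orthonormal => orthU orthWX; set G := W^T *m W.
have XGX : X^T *m (G *m X) = 1%:M.
  by rewrite -orthWX trmx_mul /G !mulmxA.
have [_ uGX] := mulmx1_unit XGX.
move: (uGX); rewrite unitmx_mul => /andP[uG uX].
have GV : invmx G = X *m X^T.
  apply: (can_inj (mulKmx uG)); rewrite mulmxV // mulmxA.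
  by rewrite (mulmx1C XGX).
have [s [_ chG /(_ uG)]] := symmetric_char_poly (trmx_gram W).
rewrite GV -(big_map GRing.inv predT (fun x => 'X - x%:P)) => chGV.
have chUX : char_poly ((U *m X)^T *m (U *m X)) = char_poly (X *m X^T).
  rewrite trmx_mul -mulmxA (mulmxA U^T) orthU mul1mx.
  by apply: (char_poly_similar uX); rewrite mulmxA.
rewrite -chUX in chGV.
apply: (perm_trans (singular_values_eigen chGV)).
rewrite perm_sym; apply: (perm_trans (perm_map _ (singular_values_eigen chG))).
rewrite -!map_comp (@eq_map _ _ _ (Num.sqrt \o GRing.inv)) // => x /=.
(* For x < 0 both sides are 0, the value of Num.sqrt on negative numbers. *)
have [x_lt0|x_ge0] := ltP x 0; last by rewrite sqrtrV.
by rewrite !ltr0_sqrtr ?invr_lt0 // invr0.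
Qed.

(** A singular Gram matrix has the eigenvalue 0, which would be a singular
    value of A. *)
Lemma gram_unitmx m n (A : 'M[R]_(m, n)) :
  last 1 (singular_values A) != 0 -> A^T *m A \in unitmx.
Proof.
move=> /singular_values_gt0 sv_gt0.
have [s [_ chG _]] := symmetric_char_poly (trmx_gram A).
rewrite unitmxE unitfE; apply/eqP => detG.
have : root (char_poly (A^T *m A)) 0.
  by rewrite /root horner_coef0 char_poly_det detG mulr0.
rewrite chG root_prod_XsubC => /(map_f Num.sqrt).
rewrite -(perm_mem (singular_values_eigen chG)) sqrtr0 => /sv_gt0.
by rewrite ltxx.
Qed.

(** (A^T A)^-1 A^T is a left inverse of A. *)
Lemma gram_unit_rank m n p (A : 'M[R]_(m, n)) (B : 'M[R]_(n, p)) :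
  A^T *m A \in unitmx -> \rank (A *m B) = \rank B.
Proof.
move=> uG; apply/eqP; rewrite eqn_leq mxrankM_maxr.
by rewrite -{1}(mulKmx uG B) -!mulmxA mulmxA mxrankM_maxr.
Qed.

Lemma orthonormal_gram_unit m n (A : 'M[R]_(m, n)) :
  Defs.orthonormal A -> A^T *m A \in unitmx.
Proof. by move->; exact: unitmx1. Qed.

Lemma orthonormal_rank m n (A : 'M[R]_(m, n)) :
  Defs.orthonormal A -> \rank A = n.
Proof.
move=> /orthonormal_gram_unit uA.
by rewrite -[A]mulmx1 gram_unit_rank // mxrank1.
Qed.

(** * Orthonormal bases of a range *)

(** Gram-Schmidt on rows: as long as V has fewer rows than the rank of A, some
    row of A lies outside the row space of V; its component orthogonal to V,
    normalised, extends V. *)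
Lemma exists_orthonormal_submx m n (A : 'M[R]_(n, m)) j : (j <= \rank A)%N ->
  exists2 V : 'M[R]_(j, m), V *m V^T = 1%:M & (V <= A)%MS.
Proof.
elim: j => [_|j IHj lt_jA].
  by exists 0; [apply/matrixP => -[] | exact: sub0mx].
have [V orthV sVA] := IHj (ltnW lt_jA).
have /row_subPn[i rNV] : ~~ (A <= V)%MS.
  apply: contraL lt_jA => /mxrankS /leq_trans /(_ (rank_leq_row V)).
  by rewrite -leqNgt.
pose w := row i A *m (1%:M - V^T *m V).
have wV : w *m V^T = 0.
  by rewrite /w -mulmxA mulmxBl mul1mx -mulmxA orthV mulmx1 subrr mulmx0.
have w_neq0 : w != 0.
  apply: contraNneq rNV; rewrite /w mulmxBr mulmx1 => /eqP.
  by rewrite subr_eq0 => /eqP ->; rewrite mulmxA submxMl.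
have sw : (w <= A)%MS.
  rewrite /w mulmxBr mulmx1 addmx_sub ?row_sub //.
  by rewrite eqmx_opp mulmxA mulmx_sub.
have wwE : w *m w^T = (\sum_l w 0 l ^+ 2)%:M.
  rewrite [LHS]mx11_scalar mxE; congr (_%:M); apply: eq_bigr => l _.
  by rewrite [w^T _ _]mxE -expr2.
set c := \sum_l _ in wwE.
have c_gt0 : 0 < c.
  rewrite lt0r sumr_ge0 ?andbT => [|l _]; last exact: sqr_ge0.
  rewrite psumr_neq0 => [|l _]; last exact: sqr_ge0.
  have /rV0Pn[l wl] := w_neq0.
  by apply/hasP; exists l; rewrite ?mem_index_enum //= lt0r sqr_ge0 sqrf_eq0 wl.
pose u := (Num.sqrt c)^-1 *: w.
rewrite -add1n; exists (col_mx u V).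
  rewrite tr_col_mx mul_col_row orthV.
  have uV : u *m V^T = 0 by rewrite -scalemxAl wV scaler0.
  have Vu : V *m u^T = 0 by rewrite -[LHS]trmxK trmx_mul trmxK uV trmx0.
  rewrite uV Vu linearZ /= -scalemxAl -scalemxAr wwE scalerA.
  rewrite -invfM -expr2 sqr_sqrtr ?ltW //.
  by rewrite scale_scalar_mx mulVf ?lt0r_neq0 // -scalar_mx_block.
by rewrite col_mx_sub scalemx_sub.
Qed.

(** [mxrange] is a column space, whereas the matrix theory of subspaces is
    about row spaces; transposition passes from one to the other. *)
Lemma mem_mxrange m n (A : 'M[R]_(m, n)) (v : 'cV[R]_m) :
  (v \in mxrange A) = (v^T <= A^T)%MS.
Proof.
apply/memv_imgP/submxP => [[x _ ->]|[x vE]].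
  by exists x^T; rewrite lfunE /= trmx_mul.
by exists x^T; rewrite ?memvf // lfunE /= -[v]trmxK vE trmx_mul trmxK.
Qed.

Lemma mxrange_sub m n p (A : 'M[R]_(m, n)) (B : 'M[R]_(m, p)) :
  (mxrange A <= mxrange B)%VS = (A^T <= B^T)%MS.
Proof.
apply/subvP/idP => [sAB|sAB v]; last first.
  by rewrite !mem_mxrange => /submx_trans; apply.
apply/row_subP => i; rewrite -[row i _]trmxK -mem_mxrange sAB //.
by rewrite mem_mxrange trmxK row_sub.
Qed.

Lemma orthonormal_basis_ofP m n k (A : 'M[R]_(m, n)) (U : 'M[R]_(m, k)) :
  orthonormal_basis_of (mxrange A) U <-> Defs.orthonormal U /\ (U^T == A^T)%MS.
Proof.
rewrite /orthonormal_basis_of; split=> -[orthU].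
  by move=> UA; split; rewrite // -!mxrange_sub UA subvv.
by move=> UA; split=> //; apply/eqP; rewrite eqEsubv !mxrange_sub.
Qed.

Lemma exists_orthonormal_basis m n (A : 'M[R]_(m, n)) :
  exists U : 'M[R]_(m, \rank A), orthonormal_basis_of (mxrange A) U.
Proof.
have [|V orthV sVA] := @exists_orthonormal_submx _ _ A^T (\rank A).
  by rewrite mxrank_tr.
exists V^T; apply/orthonormal_basis_ofP.
rewrite /Defs.orthonormal trmxK; split => //.
rewrite -(geq_leqif (mxrank_leqif_eq sVA)) mxrank_tr.
have := @orthonormal_rank _ _ V^T.
by rewrite /Defs.orthonormal trmxK mxrank_tr => ->.
Qed.

(** An orthonormal basis matrix is injective, so the dimension of its range is
    its number of columns. *)
Lemma dim_mxrange m n (A : 'M[R]_(m, n)) : \dim (mxrange A) = \rank A.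
Proof.
have [U [orthU <-]] := exists_orthonormal_basis A.
rewrite /mxrange limg_dim_eq ?dimvf /dim /= ?muln1 //.
apply/eqP; rewrite capfv; apply/lker0P => x y; rewrite !lfunE /= => UxUy.
by rewrite -[x]mul1mx -orthU -mulmxA UxUy mulmxA orthU mul1mx.
Qed.

Lemma some_orthonormal_basisP m n (A : 'M[R]_(m, n)) :
  orthonormal_basis_of (mxrange A) (some_orthonormal_basis (mxrange A)).
Proof.
have [U basisU] : exists U : 'M[R]_(m, \dim (mxrange A)),
    orthonormal_basis_of (mxrange A) U.
  by rewrite dim_mxrange; exact: exists_orthonormal_basis.
exact: (@xgetI _ 0 [set V | orthonormal_basis_of (mxrange A) V]%classic U).
Qed.

(** * The preconditioned matrix *)

(** Restricted to the first k columns, X[:, J] = Q_k R_k becomes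
    M_k^sk = Q_k A_k^sk, so that M_k^sk (A_k^sk)^-1 = Q_k.  The rank statement
    is the left cancellation of Q and the right cancellation of the
    permutation. *)
Lemma qrcp_sketch_orthonormal d n p (X : 'M[R]_(d, n)) (Q : 'M[R]_(d, p))
    (T : 'M[R]_(p, n)) (J : 'S_n) :
  is_qrcp X Q T J -> leading_block T \in unitmx ->
  \rank T = \rank X /\ Defs.orthonormal (cqrrpt_precond X T J).
Proof.
case=> orthQ _ XE XkE uT.
have rkX : \rank T = \rank X.
  rewrite -(gram_unit_rank T (orthonormal_gram_unit orthQ)) -XE col_permE.
  by rewrite mxrankMfree // row_free_unit unitmx_perm.
split=> //; rewrite -rkX in XkE.
have -> : cqrrpt_precond X T J = first_cols (\rank T) Q.
  rewrite /cqrrpt_precond XkE; apply: (can_inj (mulmxK uT)).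
  by rewrite mulmxKV // /leading_block /first_cols !mulmxA.
rewrite /Defs.orthonormal /first_cols trmx_mul -mulmxA (mulmxA Q^T) orthQ.
by rewrite mul1mx tr_pid_mx pid_mx_id ?rank_leq_row // pid_mx_1.
Qed.

(** The equation k = r is a hypothesis because the three sizes to which this
    applies, \rank M, \dim (mxrange M) and \rank Rsk, are equal without being
    convertible. *)
Lemma perm_singular_values_precond m n d k r (M : 'M[R]_(m, n))
    (S : 'M[R]_(d, m)) (U : 'M[R]_(m, k)) (Y : 'M[R]_(m, r)) :
  k = r -> orthonormal_basis_of (mxrange M) U -> (Y^T <= M^T)%MS ->
  Defs.orthonormal (S *m Y) ->
  perm_eq (singular_values Y) [seq s^-1 | s <- singular_values (S *m U)].
Proof.
move=> eq_kr; case: r / eq_kr Y => Y /orthonormal_basis_ofP[orthU /andP[_ sMU]].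
move=> /submx_trans/(_ sMU)/submxP[X YE].
have {YE} -> : Y = U *m X^T by rewrite -[LHS]trmxK YE trmx_mul trmxK.
by rewrite mulmxA => /(singular_values_inverse orthU).
Qed.

Lemma sorted_rev_inv (s : seq R) :
  {in s, forall x, 0 < x} -> sorted >=%R s ->
  sorted >=%R (rev (map GRing.inv s)).
Proof.
move=> s_gt0 ssorted; rewrite rev_sorted sorted_map.
apply: (sub_in_sorted (P := mem s)) ssorted => [x y xs ys|]; last exact/allP.
by rewrite /= lef_pV2 // posrE s_gt0.
Qed.

End SingularValues.

Theorem theorem3 (R : realType) (m n d p : nat)
    (M : 'M[R]_(m, n)) (S : 'M[R]_(d, m))
    (hnd : (n <= d)%N) (hdm : (d <= m)%N)
    (Qsk : 'M[R]_(d, p)) (Rsk : 'M[R]_(p, n)) (J : 'S_n)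
    (hqrcp : is_qrcp (S *m M) Qsk Rsk J)
    (hinv : leading_block Rsk \in unitmx)
    (hcond : restricted_cond S (mxrange M) \is a fin_num) :
  let Mpre := cqrrpt_precond M Rsk J in
  let k := \rank M in
  [/\ \rank Rsk = k,
      perm_eq (singular_values Mpre)
        [seq s^-1 | s <- restricted_singular_values S (mxrange M)] &
      forall U : 'M[R]_(m, k), orthonormal_basis_of (mxrange M) U ->
      forall i : nat, (1 <= i <= k)%N ->
        0 < sigma (S *m U) (k - i + 1) /\
        sigma Mpre i = (sigma (S *m U) (k - i + 1))^-1].
Proof.
move=> Mpre k.
have last_neq0 : last 1 (restricted_singular_values S (mxrange M)) != 0.
  by move: hcond; rewrite /restricted_cond; case: eqP.
have basisU0 := some_orthonormal_basisP M.
set U0 := some_orthonormal_basis _ in basisU0.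
have rank_SM : \rank (S *m M) = k.
  have /orthonormal_basis_ofP[orthU0 /andP[_ /submxP[Z ME]]] := basisU0.
  have {}ME : M = U0 *m Z^T by rewrite -[LHS]trmxK ME trmx_mul trmxK.
  rewrite /k [in RHS]ME (gram_unit_rank _ (orthonormal_gram_unit orthU0)).
  by rewrite [in LHS]ME mulmxA (gram_unit_rank _ (gram_unitmx last_neq0)).
have [rank_Rsk orthSMpre] := qrcp_sketch_orthonormal hqrcp hinv.
rewrite rank_SM in rank_Rsk.
(* Sketching commutes with the selection of columns and the multiplication by
   (A_k^sk)^-1, both of which act on the right. *)
have {}orthSMpre : Defs.orthonormal (S *m Mpre).
  move: orthSMpre; rewrite /Mpre /cqrrpt_precond /first_cols.
  by rewrite !col_permE !mulmxA.
have sMpre : (Mpre^T <= M^T)%MS.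
  rewrite /Mpre /cqrrpt_precond /first_cols col_permE -!mulmxA trmx_mul.
  exact: submxMl.
have perm_restr : perm_eq (singular_values Mpre)
    [seq s^-1 | s <- restricted_singular_values S (mxrange M)].
  apply: perm_singular_values_precond basisU0 sMpre orthSMpre.
  by rewrite dim_mxrange.
split=> // U basisU i /andP[i_gt0 le_ik].
have perm_U :=
  perm_singular_values_precond (esym rank_Rsk) basisU sMpre orthSMpre.
set s := singular_values (S *m U) in perm_U.
have size_s : size s = k by exact: size_singular_values.
have s_gt0 : {in s, forall x, 0 < x}.
  move=> x xs; apply: (singular_values_gt0 last_neq0).
  rewrite -(mem_map invr_inj) -(perm_mem perm_restr) (perm_mem perm_U).
  exact: map_f.
(* Two decreasing lists with the same entries are equal. *)
have MpreE : singular_values Mpre = rev [seq x^-1 | x <- s].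
  apply: (sorted_eq (leT := >=%R)).
  - by move=> y x z; exact: ge_trans.
  - by move=> x y; rewrite andbC; exact: le_anti.
  - exact: singular_values_sorted.
  - exact: sorted_rev_inv s_gt0 (singular_values_sorted _).
  - by rewrite perm_sym perm_rev perm_sym.
have lt_ki_k : (k - i < k)%N by rewrite ltn_subrL i_gt0 (leq_trans i_gt0).
rewrite /sigma addn1 /=; split; first by rewrite s_gt0 ?mem_nth ?size_s.
rewrite MpreE nth_rev size_map size_s prednK //.
by rewrite (nth_map 0) ?size_s.
Qed.
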